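(* Let $\gamma=(\gamma_s)_{s=1}^\infty$ be a sequence with $0<\gamma_s\le \frac{1}{32}$ for all $s$ and $\sum_{s=1}^\infty \gamma_s<\infty$. Let $K(\gamma)$ be the associated Cantor-type set, $h$ the associated dimension function, and $M=1+\exp\left(16\sum_{s=1}^\infty\gamma_s\right)$. Then $$\frac18\le \Lambda_h(K(\gamma))\le \frac{M}{2}.$$
   Context: Notation: $\mathbb{N}=\{1,2,\dots\}$, $\log$ is the natural logarithm. The set $K(\gamma)$. Given $\gamma=(\gamma_s)_{s=1}^\infty$ with $0<\gamma_s\le\frac1{32}$, let $r_0=1$ and $r_s=\gamma_s r_{s-1}^2$ for $s\in\mathbb{N}$. Define real polynomials by $P_2(x)=x(x-1)$ and $P_{2^{s+1}}=P_{2^s}\cdot(P_{2^s}+r_s)$ for $s\in\mathbb{N}$. For $s\ge 0$ let $E_s=\{x\in\mathbb{R}: P_{2^{s+1}}(x)\le 0\}$. The set $E_s$ is a disjoint union of $2^s$ closed intervals $I_{j,s}$, $1\le j\le 2^s$ (the basic intervals of level $s$), with $E_{s+1}\subset E_s$ and $\max_j |I_{j,s}|\to0$ as $s\to\infty$. Define $K(\gamma)=\bigcap_{s=0}^\infty E_s$. The dimension function $h$. Let $\delta_0=1$ and $\delta_s=\gamma_1\gamma_2\cdots\gamma_s$ for $s\in\mathbb{N}$. Define $\eta:(0,1]\to[0,\infty)$ by $\eta(\delta_s)=s$ for $s\ge 0$ and $$\eta(t)=s+\frac{\log(\delta_s/t)}{\log(\delta_s/\delta_{s+1})}\quad\text{for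 } \delta_{s+1}<t<\delta_s,\ s\ge 0.$$ Define $h(0)=0$, $h(t)=2^{-\eta(t)}$ for $0<t\le1$, and $h(t)=1$ for $t>1$. Hausdorff measure. For $E\subset\mathbb{C}$, $$\Lambda_h(E)=\lim_{\delta\to0}\inf\left\{\sum_j h(r_j): E\subset\bigcup_j B(z_j,r_j),\ r_j\le\delta\right\},$$ where the infimum is over countable covers and $B(z,r)$ is the open ball of center $z$ and radius $r$ in $\mathbb{C}$. *)

(* Defs.v *)
From HB Require Import structures.
From mathcomp Require Import all_boot all_order all_algebra.
From mathcomp Require Import complex.
From mathcomp Require Import all_classical all_reals all_analysis.

Set Implicit Arguments.
Unset Strict Implicit.
Unset Printing Implicit Defensive.

Import Order.TTheory GRing.Theory Num.Theory.
Import numFieldNormedType.Exports.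

Local Open Scope classical_set_scope.
Local Open Scope ring_scope.

(* The parameter sequence is gamma 1, gamma 2, ...; the value gamma 0 is never
   used below. *)

Section CantorSet.
Context {R : realType}.
Implicit Types gamma : nat -> R.

Fixpoint rad gamma (s : nat) : R :=
  if s is s'.+1 then gamma s * rad gamma s' ^+ 2 else 1.

(* Ppow gamma s is the polynomial P_{2^(s+1)}, of degree 2^(s+1). *)
Fixpoint Ppow gamma (s : nat) : {poly R} :=
  if s is s'.+1 then Ppow gamma s' * (Ppow gamma s' + (rad gamma s)%:P)
  else 'X * ('X - 1).

Definition levelE gamma (s : nat) : set R := [set x | (Ppow gamma s).[x] <= 0].

Definition cantorK gamma : set R := \bigcap_s levelE gamma s.

End CantorSet.

Section DimensionFunction.
Context {R : realType}.
Implicit Types gamma : nat -> R.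

Definition delta gamma (s : nat) : R := \prod_(1 <= k < s.+1) gamma k.

(* The s with delta_{s+1} < t <= delta_s; it exists and is unique when
   0 < t <= 1 and 0 < gamma_k <= 1/32 for all k >= 1. *)
Definition level gamma (t : R) : nat :=
  xget 0%N [set s | delta gamma s.+1 < t <= delta gamma s].

(* At t = delta_s the logarithmic term vanishes, so the value is s: see
   eta_delta and eta_interval for the two defining clauses. *)
Definition eta gamma (t : R) : R :=
  let s := level gamma t in
  s%:R + ln (delta gamma s / t) / ln (delta gamma s / delta gamma s.+1).

Definition dimh gamma (t : R) : R :=
  if t <= 0 then 0 else if t <= 1 then 2 `^ (- eta gamma t) else 1.

Section EtaSpec.
Context (gamma : nat -> R)
  (hgamma : forall s, (1 <= s)%N -> 0 < gamma s <= 32%:R^-1).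

Lemma deltaS s : delta gamma s.+1 = delta gamma s * gamma s.+1.
Proof. by rewrite /delta big_nat_recr. Qed.

Lemma delta_gt0 s : 0 < delta gamma s.
Proof.
elim: s => [|s IHs]; first by rewrite /delta big_geq.
by rewrite deltaS mulr_gt0//; have /andP[] := hgamma (ltn0Sn s).
Qed.

Lemma delta_decr s : delta gamma s.+1 < delta gamma s.
Proof.
rewrite deltaS -[ltRHS]mulr1 ltr_pM2l ?delta_gt0//.
have /andP[_ /le_lt_trans->//] := hgamma (ltn0Sn s).
by rewrite invf_lt1 ?ltr1n// ltr0n.
Qed.

Lemma delta_le m n : (m <= n)%N -> delta gamma n <= delta gamma m.
Proof.
elim: n => [|n IHn]; first by rewrite leqn0 => /eqP->.
rewrite leq_eqVlt => /predU1P[->//|mn].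
exact: le_trans (ltW (delta_decr n)) (IHn mn).
Qed.

Lemma levelP s t : delta gamma s.+1 < t <= delta gamma s -> level gamma t = s.
Proof.
move=> st; rewrite /level; case: xgetP => [u _ /= ut|/(_ s)/(_ st)//].
move: st ut => /andP[s1 s2] /andP[u1 u2].
case: (ltngtP u s) => // us.
- by have := le_lt_trans (le_trans s2 (delta_le us)) u1; rewrite ltxx.
- by have := le_lt_trans (le_trans u2 (delta_le us)) s1; rewrite ltxx.
Qed.

Lemma eta_delta s : eta gamma (delta gamma s) = s%:R.
Proof.
rewrite /eta (@levelP s) ?delta_decr ?lexx// divff ?gt_eqF ?delta_gt0//.
by rewrite ln1 mul0r addr0.
Qed.

Lemma eta_interval s t : delta gamma s.+1 < t < delta gamma s ->
  eta gamma t =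
  s%:R + ln (delta gamma s / t) / ln (delta gamma s / delta gamma s.+1).
Proof.
by move=> /andP[s1 s2]; rewrite /eta (@levelP s)// s1 ltW.
Qed.

End EtaSpec.
End DimensionFunction.

Section HausdorffMeasure.
Context {R : realType}.
Local Open Scope complex_scope.

(* The norm of R[i] takes values in R[i]; its order restricted to the reals is
   the usual one. *)
Definition cball (z : R[i]) (r : R) : set R[i] := [set w | `|w - z| < r%:C].

Definition hausdorff_content (h : R -> R) (E : set R[i]) (d : R) : \bar R :=
  ereal_inf [set v | exists (J : set nat) (z : nat -> R[i]) (r : nat -> R),
    [/\ forall j, J j -> 0 < r j <= d,
        E `<=` \bigcup_(j in J) cball (z j) (r j)
      & v = \esum_(j in J) (h (r j))%:E]].

Definition hausdorff_measure (h : R -> R) (E : set R[i]) : \bar R :=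
  lim (hausdorff_content h E d @[d --> 0^'+]).

Lemma hausdorff_content_cvg (h : R -> R) (E : set R[i]) :
  cvg (hausdorff_content h E d @[d --> 0^'+]).
Proof.
apply/cvg_ex; exists (ereal_sup (hausdorff_content h E @` [set` `]0, 1[])).
apply: nonincreasing_at_right_cvge; first by rewrite bnd_simp.
move=> d d' _ _ dd'; apply: ereal_inf_le_tmp => _ [J [z [r [hr cov ->]]]].
exists J, z, r; split=> // j /hr /andP[-> /=] /le_trans; exact.
Qed.

Definition embedC (A : set R) : set R[i] := [set x%:C | x in A].

End HausdorffMeasure.

(* Main.v *)
Require Import Defs.
From mathcomp Require Import all_boot all_order all_algebra.
From mathcomp Require Import finmap complex ring lra.
From mathcomp Require Import all_classical all_reals all_analysis.

Import Order.TTheory GRing.Theory Num.Theory.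
Import numFieldNormedType.Exports.

Local Open Scope classical_set_scope.
Local Open Scope ring_scope.

(** Put [y_0 = x] and [y_s = y_{s-1} (1 - y_{s-1}) / gamma_s].  Then
    [P_{2^(s+1)}(x) = r_s^2 y_s (y_s - 1)], so [K(gamma)] is the set of the
    points whose orbit under this non-autonomous logistic system never leaves
    [0, 1], and everything reduces to the expansion of the logistic maps.

    Since [y_s (1 - y_s) = gamma_{s+1} y_{s+1}] is at most [1/32], an orbit
    staying in [0, 1] avoids the middle of the interval: [|1 - 2 y_s| >= 7/8].
    The word of a point records on which side of [1/2] its [y_s] lie, and each
    binary word is realised by a point of [K(gamma)] (follow inverse branches
    back from 0).  One step multiplies the distance of two points by
    [|1 - y - y'| / gamma].

    This factor is at most [1 / gamma]; hence two points of [K(gamma)] whose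
    words first differ at place [i] are at least [7/8 delta_i] apart
    ([orbit_expand], [branch_separation]), and a ball of radius at most
    [delta_k] sees only one word of length [k] ([cantorK_close]).  On the same
    side of [1/2] the factor is at least [(1 - 4 gamma) / gamma], hence at least
    [exp(- 16 gamma) / gamma]; so two points of [K(gamma)] with the same first
    [s] letters are within [delta_s exp(16 sum gamma)] ([orbit_contract]).

    Lower bound: by compactness a cover may be taken finite.  Attach to each
    ball a level [k_j] with [h(r_j) >= 2^-(k_j + 1)] and, unless [k_j = 0],
    [r_j <= delta_{k_j}].
    For [n] large, the [2^n] words of length [n] give points of [K(gamma)], of
    which the [j]-th ball holds at most [2^(n - k_j)]; thus
    [1 <= sum_j 2^-k_j <= 2 sum_j h(r_j)], which proves the bound [1/2] in
    place of [1/8].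

    Upper bound: [2^s] balls of radius [(M / 2) delta_s], centred at the points
    whose orbit is at [1/2] at time [s], cover [K(gamma)], and
    [h(c delta_s) <= c h(delta_s) = c 2^-s] as soon as
    [c delta_s <= delta_{s-1}], which holds for large [s] because [gamma_s]
    tends to 0. *)

(** * The Cantor set as a set of bounded orbits *)

Section Expansion.
Context {R : realType} (gamma : nat -> R)
  (hgamma : forall s : nat, (1 <= s)%N -> 0 < gamma s <= 32%:R^-1).

Let gamma_gt0 s : 0 < gamma s.+1.
Proof. by have /andP[] := hgamma s.+1 (ltn0Sn s). Qed.

Let gamma_le s : gamma s.+1 <= 32%:R^-1.
Proof. by have /andP[] := hgamma s.+1 (ltn0Sn s). Qed.

Fixpoint orbit (s : nat) (x : R) : R :=
  if s is s'.+1 then orbit s' x * (1 - orbit s' x) / gamma s else x.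

(** The inverse branches of [y |-> y (1 - y) / gamma_s]; [b] tells on which side
    of [1/2] the preimage lies. *)
Definition branch (s : nat) (b : bool) (z : R) : R :=
  (1 + (-1) ^+ (~~ b) * Num.sqrt (1 - 4 * gamma s * z)) / 2.

(** The point whose orbit follows the first [n] letters of [w] and is at [z] at
    time [n]. *)
Fixpoint code_point (n : nat) (w : nat -> bool) (z : R) : R :=
  if n is n'.+1 then code_point n' w (branch n (w n') z) else z.

Lemma rad_gt0 s : 0 < Defs.rad gamma s.
Proof. by elim: s => //= s ih; rewrite mulr_gt0// exprn_gt0. Qed.

Lemma Ppow_orbit s x :
  (Ppow gamma s).[x] = Defs.rad gamma s ^+ 2 * (orbit s x * (orbit s x - 1)).
Proof.
elim: s => [|s ih] /=; first by rewrite !hornerE [RHS]/= expr1n mul1r.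
rewrite hornerM hornerD hornerC ih.
by field; rewrite gt_eqF.
Qed.

Lemma levelEP s x : levelE gamma s x <-> 0 <= orbit s x <= 1.
Proof.
rewrite /levelE /= Ppow_orbit pmulr_rle0 ?exprn_gt0 ?rad_gt0//.
split=> [h|/andP[h0 h1]]; last by rewrite mulr_ge0_le0// subr_le0.
by apply/andP; split; nra.
Qed.

Lemma cantorKP x : cantorK gamma x <-> forall s, 0 <= orbit s x <= 1.
Proof. by split=> h s; [apply/levelEP; exact: h|move=> _; apply/levelEP]. Qed.

(** Completing the square in the recursion: the next point of the orbit controls
    the distance to [1/2], where the logistic map fails to expand. *)
Lemma sqr_dist_half s x :
  (1 - 2 * orbit s x) ^+ 2 = 1 - 4 * gamma s.+1 * orbit s.+1 x.
Proof. by rewrite /=; field; rewrite gt_eqF. Qed.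

(** By [sqr_dist_half], [|1 - 2 y|^2 >= 1 - 4/32 = 7/8], so each point is at
    least [7/16] away from [1/2], on its own side. *)
Lemma branch_separation s x x' :
    0 <= orbit s.+1 x <= 1 -> 0 <= orbit s.+1 x' <= 1 ->
    (2^-1 < orbit s x) != (2^-1 < orbit s x') ->
  7 / 8 <= `|orbit s x - orbit s x'|.
Proof.
move=> hx hx'; have := sqr_dist_half s x; have := sqr_dist_half s x'.
move: hx hx' => /andP[a0 a1] /andP[b0 b1].
have := gamma_gt0 s; have := gamma_le s.
move: (gamma s.+1) (orbit s.+1 x) (orbit s.+1 x') a0 a1 b0 b1 => g a b.
move: (orbit s x) (orbit s x') => u v a0 a1 b0 b1 g1 g0 hv hu.
have hga : g * a <= 32%:R^-1 by nra.
have hgb : g * b <= 32%:R^-1 by nra.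
have {}hu : 7 / 8 <= (1 - 2 * u) ^+ 2 by lra.
have {}hv : 7 / 8 <= (1 - 2 * v) ^+ 2 by lra.
have sq p : 0 <= p -> 7 / 8 <= p ^+ 2 -> 7 / 8 <= p :> R by move=> p0 hp; nra.
rewrite lter_normr; case: ltP => hu2; case: ltP => hv2 //= _.
- have := sq (2 * u - 1); have := sq (1 - 2 * v).
  by move=> hp hq; apply/orP; left; nra.
- have := sq (1 - 2 * u); have := sq (2 * v - 1).
  by move=> hp hq; apply/orP; right; nra.
Qed.

(** One step multiplies the distance by [|1 - y - y'| / gamma], and
    [|1 - y - y'| <= 1] for [y, y'] in [0, 1]. *)
Lemma orbit_expand k x x' :
    (forall i, (i <= k)%N -> 0 <= orbit i x <= 1) ->
    (forall i, (i <= k)%N -> 0 <= orbit i x' <= 1) ->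
  delta gamma k * `|orbit k x - orbit k x'| <= `|x - x'|.
Proof.
elim: k => [|k ih] hx hx'; first by rewrite /delta big_geq// mul1r.
have := ih (fun i ik => hx i (leqW ik)) (fun i ik => hx' i (leqW ik)).
apply: le_trans; rewrite deltaS -mulrA ler_pM2l ?delta_gt0//.
have -> : orbit k.+1 x - orbit k.+1 x' =
    (gamma k.+1)^-1 * ((1 - orbit k x - orbit k x') * (orbit k x - orbit k x')).
  by rewrite /=; field; rewrite gt_eqF.
rewrite normrM gtr0_norm ?invr_gt0// mulVKf ?gt_eqF//.
rewrite normrM ler_piMl// ler_norml.
have /andP[] := hx k (leqnSn k); have /andP[] := hx' k (leqnSn k).
by move=> *; apply/andP; split; lra.
Qed.

(** On the same side of [1/2], [|1 - y - y'|] is the mean of [|1 - 2 y|] and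
    [|1 - 2 y'|], each of which is at least its square, hence at least
    [1 - 4 gamma]; and [exp(16 gamma) (1 - 4 gamma) >= 1], by
    [exp t >= 1 + t] and [gamma <= 1/32]. *)
Lemma orbit_contract k x x' :
    (forall i, (i <= k)%N -> 0 <= orbit i x <= 1) ->
    (forall i, (i <= k)%N -> 0 <= orbit i x' <= 1) ->
    (forall i, (i < k)%N -> (2^-1 < orbit i x) = (2^-1 < orbit i x')) ->
  `|x - x'| <=
  delta gamma k * expR (16 * \sum_(1 <= i < k.+1) gamma i) *
  `|orbit k x - orbit k x'|.
Proof.
elim: k => [|k ih] hx hx' hb.
  by rewrite /delta !big_geq// mulr0 expR0 !mul1r.
have := ih (fun i ik => hx i (leqW ik)) (fun i ik => hx' i (leqW ik))
  (fun i ik => hb i (leqW ik)).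
move/le_trans; apply.
rewrite deltaS [in leRHS]big_nat_recr//= mulrDr expRD.
rewrite [leRHS](_ : _ = delta gamma k * expR (16 * \sum_(1 <= i < k.+1) gamma i)
  * (expR (16 * gamma k.+1) * (gamma k.+1 * `|orbit k.+1 x - orbit k.+1 x'|)));
  last by rewrite /=; ring.
rewrite ler_pM2l ?mulr_gt0 ?expR_gt0 ?delta_gt0//.
have -> : gamma k.+1 * `|orbit k.+1 x - orbit k.+1 x'| =
    `|1 - orbit k x - orbit k x'| * `|orbit k x - orbit k x'|.
  rewrite -[X in X * _]gtr0_norm// -!normrM; congr `|_|.
  by rewrite /=; field; rewrite gt_eqF.
rewrite mulrA ler_peMl//.
have := expR_ge1Dx (16 * gamma k.+1).
have : 1 - 4 * gamma k.+1 <= `|1 - orbit k x - orbit k x'|.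
  have /andP[a0 a1] := hx k (leqnSn k); have /andP[b0 b1] := hx' k (leqnSn k).
  have /andP[c0 c1] := hx k.+1 (leqnn _).
  have /andP[d0 d1] := hx' k.+1 (leqnn _).
  have := sqr_dist_half k x; have := sqr_dist_half k x'.
  have := gamma_gt0 k; have := gamma_le k; have := hb k (leqnn _).
  move: (gamma k.+1) (orbit k.+1 x) (orbit k.+1 x') c0 c1 d0 d1 => g a b.
  move: (orbit k x) (orbit k x') a0 a1 b0 b1 => u v a0 a1 b0 b1.
  move=> c0 c1 d0 d1 + g1 g0 hv hu.
  have {}hu : 1 - 4 * g <= (1 - 2 * u) ^+ 2 by nra.
  have {}hv : 1 - 4 * g <= (1 - 2 * v) ^+ 2 by nra.
  rewrite lter_normr; case: ltP => hu2; case: ltP => hv2 //= _.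
  - by apply/orP; right; nra.
  - by apply/orP; left; nra.
have := gamma_gt0 k; have := gamma_le k.
by move: (gamma k.+1) (expR _) `|_| => g e d g1 g0 hd he; nra.
Qed.

Lemma branchP s b z : 0 <= z <= 1 ->
  [/\ 0 <= branch s.+1 b z <= 1, (2^-1 < branch s.+1 b z) = b &
      branch s.+1 b z * (1 - branch s.+1 b z) / gamma s.+1 = z].
Proof.
move=> /andP[z0 z1]; have g0 := gamma_gt0 s; have g1 := gamma_le s.
have gz : 0 <= gamma s.+1 * z <= 32%:R^-1 by apply/andP; split; nra.
move: gz => /andP[gz0 gz1].
have hq : Num.sqrt (1 - 4 * gamma s.+1 * z) ^+ 2 = 1 - 4 * gamma s.+1 * z.
  by rewrite sqr_sqrtr//; lra.
have q0 : 0 < Num.sqrt (1 - 4 * gamma s.+1 * z) by rewrite sqrtr_gt0; lra.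
rewrite /branch; move: (Num.sqrt _) hq q0 => q hq q0.
have q1 : q <= 1 by nra.
split.
- by case: b => /=; rewrite ?expr0 ?expr1; apply/andP; split; lra.
- case: b => /=; rewrite ?expr0 ?expr1; first by apply/idP; lra.
  by apply/negbTE; rewrite -leNgt; lra.
- apply: (canLR (mulfK _)); first by rewrite gt_eqF.
  case: b => /=; rewrite ?expr0 ?expr1.
  + transitivity ((1 - q ^+ 2) / 4); first by field.
    by rewrite hq; field.
  + transitivity ((1 - q ^+ 2) / 4); first by field.
    by rewrite hq; field.
Qed.

Lemma code_pointP n w z : 0 <= z <= 1 ->
  [/\ orbit n (code_point n w z) = z,
      forall i, (i <= n)%N -> 0 <= orbit i (code_point n w z) <= 1 &
      forall i, (i < n)%N -> (2^-1 < orbit i (code_point n w z)) = w i].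
Proof.
elim: n z => [|n ih] z hz; first by split => // i; rewrite leqn0 => /eqP ->.
have [hb1 hb2 hb3] := branchP n (w n) z hz.
have [h1 h2 h3] := ih _ hb1.
have hz' : orbit n.+1 (code_point n.+1 w z) = z by rewrite /= h1.
split => // i.
- by rewrite leq_eqVlt => /predU1P[->|/h2//]; rewrite hz'.
- by rewrite ltnS leq_eqVlt => /predU1P[->|/h3//]; rewrite /= h1.
Qed.

(** 0 is a fixed point of every logistic map, so the orbit stays there from time
    [n] on. *)
Lemma code_point_cantorK n w : cantorK gamma (code_point n w 0).
Proof.
have [|h0 hle _] := code_pointP n w 0; first by rewrite lexx ler01.
apply/cantorKP => s; have [/hle//|ns] := leqP s n.
have -> : orbit s (code_point n w 0) = 0; last by rewrite lexx ler01.
rewrite -(subnKC (ltnW ns)); elim: (s - n)%N => [|m ih]; first by rewrite addn0.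
by rewrite addnS /= ih !mul0r.
Qed.

(** Words differing first at place [i < n] would force a distance of at least
    [7/8 delta_i], whereas [2 delta_n <= 2/32 delta_i]. *)
Lemma cantorK_close n r x x' : cantorK gamma x -> cantorK gamma x' ->
    r <= delta gamma n -> `|x - x'| < 2 * r ->
  forall i, (i < n)%N -> (2^-1 < orbit i x) = (2^-1 < orbit i x').
Proof.
move=> /cantorKP Kx /cantorKP Kx' rn xx' i ilt.
apply/eqP/negPn/negP => /(branch_separation _ _ _ (Kx _) (Kx' _)) far.
have := orbit_expand i x x' (fun j _ => Kx j) (fun j _ => Kx' j).
have di := delta_gt0 hgamma i.
have : delta gamma n <= delta gamma i / 32.
  apply: (le_trans (delta_le hgamma ilt)).
  by rewrite deltaS ler_pM2l.
move: far; move: `|_ - _| `|x - x'| (delta _ i) (delta _ n) di xx' rn.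
by move=> a b c d; nra.
Qed.

(** * Gauge function *)

Lemma near_delta_lt t : 0 < t -> \forall n \near \oo, delta gamma n < t.
Proof.
move=> t0; have := near_infty_natSinv_expn_lt (PosNum t0).
apply: filterS => n /=; apply: le_lt_trans; rewrite div1r -exprVn.
elim: n => [|n ih]; first by rewrite /delta big_geq.
rewrite deltaS exprSr ler_pM// ?ltW// ?delta_gt0//.
by have := gamma_le n; lra.
Qed.

Lemma dimh_ge0 t : 0 <= dimh gamma t.
Proof. by rewrite /dimh; do 2 case: ifP => // _; rewrite powR_ge0. Qed.

Lemma ln_delta_ratio n :
  ln 2 <= ln (delta gamma n / delta gamma n.+1).
Proof.
rewrite deltaS invfM mulrA divff ?mul1r ?gt_eqF ?delta_gt0//.
rewrite ler_ln ?posrE ?invr_gt0// -[2]invrK lef_pV2 ?posrE ?invr_gt0//.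
by have := gamma_le n; lra.
Qed.

(** The level of [r] is the [k] with [delta_{k+1} < r <= delta_k]; as [h] is
    monotone, [h r >= h delta_{k+1}].  Radii larger than 1 get level 0. *)
Lemma dimh_ge r : 0 < r -> exists k,
  (k = 0%N \/ r <= delta gamma k) /\ 2^-1 ^+ k.+1 <= dimh gamma r.
Proof.
move=> r0; have [r1|r1] := leP r 1; last first.
  exists 0%N; split; first by left.
  by rewrite /dimh (lt_geF r0) (lt_geF r1) expr1; lra.
have exn : exists n, delta gamma n < r.
  by have [N _ /(_ N (leqnn N))] := near_delta_lt r r0; exists N.
case: (ex_minnP exn) => -[|k] hk hmin.
  by move: hk; rewrite /delta big_geq// ltNge r1.
have rk : r <= delta gamma k.
  by rewrite leNgt; apply/negP => /hmin; rewrite ltnn.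
exists k; split; first by right.
rewrite /dimh (lt_geF r0) r1 /eta (@levelP _ _ hgamma k) ?hk//.
rewrite exprVn -powR_mulrn// -powRN ler_powR ?ler1n//.
have D k' := @delta_gt0 _ _ hgamma k'.
have L := ln_delta_ratio k.
have L0 : 0 < ln (delta gamma k / delta gamma k.+1).
  by apply: lt_le_trans L; rewrite ln_gt0 ?ltr1n.
rewrite lerN2 -natr1 lerD2l ler_pdivrMr// mul1r.
by rewrite ler_ln ?posrE ?divr_gt0// ler_pM2l// lef_pV2 ?posrE// ltW.
Qed.

(** Between [delta_{n+1}] and [delta_n], [h t] is proportional to [t] to the
    power [ln 2 / ln (1 / gamma_{n+1})], which is at most 1. *)
Lemma dimh_scale c n : 1 < c -> c * gamma n.+1 <= 1 ->
  dimh gamma (c * delta gamma n.+1) <= c * 2^-1 ^+ n.+1.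
Proof.
move=> c1 cg; have D k' := @delta_gt0 _ _ hgamma k'.
have c0 : 0 < c by lra.
have cD : c * delta gamma n.+1 <= delta gamma n.
  by rewrite deltaS mulrCA ler_piMr// ltW.
have cD1 : c * delta gamma n.+1 <= 1.
  apply: (le_trans cD); apply: (le_trans (delta_le hgamma (leq0n n))).
  by rewrite /delta big_geq.
rewrite /dimh (lt_geF (mulr_gt0 c0 (D n.+1))) cD1 /eta.
rewrite (@levelP _ _ hgamma n); last first.
  by rewrite cD ltr_pMl// c1.
have L := ln_delta_ratio n.
have L2 : 0 < ln (2 : R) by rewrite ln_gt0 ?ltr1n.
have -> : ln (delta gamma n / (c * delta gamma n.+1)) =
    ln (delta gamma n / delta gamma n.+1) - ln c.
  by rewrite [c * _]mulrC invfM mulrA [LHS]ln_div ?posrE ?divr_gt0.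
move: (ln (_ / _)) L => g L.
have g0 : 0 < g by lra.
rewrite mulrBl divff ?gt_eqF// addrA natr1 opprB.
rewrite powRD ?pnatr_eq0 ?implybT// powRN powR_mulrn// exprVn.
rewrite ler_pM2r ?invr_gt0 ?exprn_gt0//.
rewrite /powR pnatr_eq0/= -[leRHS]lnK ?posrE// ler_expR.
by rewrite -mulrA ler_piMr ?ln_ge0 ?(ltW c1)// mulrC ler_pdivrMr// mul1r.
Qed.

End Expansion.

(** * Counting words *)

Lemma card_tuple_prefix n k (A : {set n.-tuple bool}) : (k <= n)%N ->
    {in A &, forall w w' : n.-tuple bool,
       forall i, (i < k)%N -> nth false w i = nth false w' i} ->
  (#|A| <= 2 ^ (n - k))%N.
Proof.
move=> kn hA; rewrite -[2%N]card_bool -card_tuple.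
have dropI : {in A &, injective (fun w : n.-tuple bool => [tuple of drop k w])}.
  move=> w w' wA w'A /(congr1 val) /= dww'.
  apply: val_inj; rewrite /= -(cat_take_drop k w) -(cat_take_drop k w') dww'.
  congr (_ ++ _); apply: (@eq_from_nth _ false).
    by rewrite !size_takel ?size_tuple.
  move=> i; rewrite size_takel ?size_tuple// => ik.
  by rewrite !nth_take//; exact: hA.
by rewrite -(card_in_imset dropI) max_card.
Qed.

Lemma card_bigcup_seq_le (T : finType) (I : Type) (s : seq I)
    (F : I -> {set T}) :
  (#|\bigcup_(i <- s) F i|%SET <= \sum_(i <- s) #|F i|)%N.
Proof.
elim/big_rec2: _ => [|i m U _ Um]; first by rewrite cards0.
by rewrite (leq_trans (leq_card_setU _ _).1)// leq_add2l.
Qed.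

(** * Bounds on the Hausdorff contents *)

Section HausdorffBounds.
Context {R : realType} (gamma : nat -> R)
  (hgamma : forall s : nat, (1 <= s)%N -> 0 < gamma s <= 32%:R^-1).

Lemma cantorK_compact : compact (cantorK gamma).
Proof.
apply: (subclosed_compact _ (@segment_compact R 0 1)).
  apply: closed_bigI => s _.
  apply: (@preimage_closed _ _ (horner (Ppow gamma s)) [set y | y <= 0]).
    by move=> x _; exact: continuous_horner.
  exact: closed_le.
by move=> x /(cantorKP _ hgamma)/(_ 0%N); rewrite /= in_itv.
Qed.

(** The mass distribution principle in finite form: with [n] beyond the levels
    of all the balls, counting words of length [n] plays the role of the measure
    giving mass [2^-s] to each basic interval of level [s]. *)
Lemma finite_cover_dimh (D : seq nat) (a r : nat -> R) :
    (forall j, j \in D -> 0 < r j) ->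
    (forall x, cantorK gamma x -> exists2 j, j \in D & `|x - a j| < r j) ->
  2^-1 <= \sum_(j <- D) dimh gamma (r j).
Proof.
move=> r0 cov.
have /choice[k hk] : forall j, exists k, j \in D ->
    (k = 0%N \/ r j <= delta gamma k) /\ 2^-1 ^+ k.+1 <= dimh gamma (r j).
  move=> j; case: (boolP (j \in D)) => [jD|]; last by exists 0%N.
  by have [k hk] := dimh_ge _ hgamma _ (r0 j jD); exists k.
pose n := \max_(j <- D) k j.
have kn j : j \in D -> (k j <= n)%N by move=> jD; rewrite /n leq_bigmax_seq.
pose p (w : n.-tuple bool) := code_point gamma n (nth false w) 0.
pose A j := [set w | `|p w - a j| < r j]%SET.
have cA : (2 ^ n <= \sum_(j <- D) #|A j|)%N.
  rewrite -[2%N]card_bool -card_tuple -cardsT.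
  apply: leq_trans (card_bigcup_seq_le _ _ _ _).
  apply/subset_leq_card/fintype.subsetP => w _.
  have [j jD wj] := cov _ (code_point_cantorK _ hgamma n (nth false w)).
  by rewrite (big_rem j jD) !inE wj.
have sA j : j \in D -> (#|A j| <= 2 ^ (n - k j))%N.
  move=> jD; apply: card_tuple_prefix; first exact: kn.
  have [[-> //|rj] _] := hk j jD.
  move=> w w'; rewrite !inE => wj w'j i ik.
  have z01 : 0 <= (0 : R) <= 1 by rewrite lexx ler01.
  have [_ _ cw] := code_pointP _ hgamma n (nth false w) 0 z01.
  have [_ _ cw'] := code_pointP _ hgamma n (nth false w') 0 z01.
  have iltn := leq_trans ik (kn j jD).
  rewrite -cw// -cw'//.
  apply: (cantorK_close _ hgamma (k j) (r j)) => //.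
  - exact: code_point_cantorK.
  - exact: code_point_cantorK.
  - rewrite (le_lt_trans (ler_distD (a j) _ _))// [X in _ + X]distrC mulr_natl.
    exact: ltrD.
have {}cA : (2 ^ n)%:R <= \sum_(j <- D) (2 ^ (n - k j))%:R :> R.
  rewrite -natr_sum ler_nat (leq_trans cA)// big_seq [leqRHS]big_seq.
  exact: leq_sum.
have p2 : 0 < 2 ^+ n :> R by rewrite exprn_gt0.
rewrite -(ler_pM2l p2) -natrX; have h0 : 0 <= 2^-1 :> R by lra.
apply: (le_trans (ler_wpM2r h0 cA)).
rewrite mulr_suml mulr_sumr big_seq [leRHS]big_seq.
apply: ler_sum => j jD; have [_ hj] := hk j jD.
rewrite !natrX (le_trans _ (ler_wpM2l (ltW p2) hj))// exprSr mulrA.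
by rewrite ler_wpM2r// -{2}(subnK (kn j jD)) exprD -mulrA exprVn divff ?mulr1.
Qed.

(** Replacing the centres by their real parts reduces a cover in the plane to a
    cover by intervals of the same radii. *)
Lemma hausdorff_content_ge d : ((2^-1)%:E <=
  hausdorff_content (dimh gamma) (embedC (cantorK gamma)) d)%E.
Proof.
apply: le_ereal_inf_tmp => _ [J [z [r [hr cov ->]]]].
have := cantorK_compact; rewrite compact_cover.
case/(_ nat J (fun j => ball (complex.Re (z j)) (r j))).
- by move=> j Jj; apply: ball_open; have /andP[] := hr j Jj.
- move=> x Kx; have [|j Jj] := cov (real_complex R x); first by exists x.
  rewrite /cball /= normc_def ltcR => xj; exists j => //.
  rewrite -ball_normE /= distrC; apply: le_lt_trans xj.
  by case: (z j) => u v /=; rewrite -sqrtr_sqr ler_wsqrtr//= lerDl sqr_ge0.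
move=> D DJ covD; apply: esum_ge; exists [set` D].
  by split; [exact: finite_fset|move=> j /= /DJ; rewrite inE].
rewrite fsbig_finite ?finite_fset//= set_fsetK sumEFin lee_fin.
apply: (@finite_cover_dimh _ (fun j => complex.Re (z j))).
- by move=> j /DJ; rewrite inE => /hr /andP[].
- move=> x /covD[j jD]; rewrite -ball_normE /= => xj.
  by exists j => //; rewrite distrC.
Qed.

(** The centre is the point with the same word whose orbit reaches [1/2]: the
    midpoint is within [1/2] of all of [0, 1], which gains a factor 2 over the
    length of the basic interval. *)
Lemma cantorK_near_code_point n x : cantorK gamma x ->
  exists w : n.-tuple bool, `|x - code_point gamma n (nth false w) 2^-1| <=
    delta gamma n * expR (16 * \sum_(1 <= i < n.+1) gamma i) / 2.
Proof.
move=> /(cantorKP _ hgamma) Kx.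
exists [tuple 2^-1 < orbit gamma i x | i < n].
set w := nth false _.
have z01 : 0 <= (2^-1 : R) <= 1 by apply/andP; split; lra.
have [yn hy wy] := code_pointP _ hgamma n w 2^-1 z01.
have := orbit_contract _ hgamma n _ _ (fun i _ => Kx i) hy.
move=> /(_ _)/le_trans; apply.
  move=> i ilt; rewrite wy//.
  have := tnth_mktuple (fun j : 'I_n => 2^-1 < orbit gamma j x) (Ordinal ilt).
  by rewrite (tnth_nth false) /w => <-.
rewrite yn ler_wpM2l ?mulr_ge0 ?expR_ge0 ?(ltW (delta_gt0 hgamma n))//.
by have /andP[y0 y1] := Kx n; rewrite ler_norml; apply/andP; split; lra.
Qed.

(** The balls of radius [c delta_{n+1}] around the centres of the [2^(n+1)]
    words of length [n + 1] have total gauge at most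
    [2^(n+1) (c 2^-(n+1)) = c]. *)
Lemma hausdorff_content_le n (c d : R) : 1 < c -> c * gamma n.+1 <= 1 ->
    c * delta gamma n.+1 <= d ->
    expR (16 * \sum_(1 <= i < n.+2) gamma i) < 2 * c ->
  (hausdorff_content (dimh gamma) (embedC (cantorK gamma)) d <= c%:E)%E.
Proof.
move=> c1 cg cd hc.
have D0 := @delta_gt0 _ _ hgamma n.+1.
pose e := enum {: n.+1.-tuple bool}.
have se : size e = (2 ^ n.+1)%N by rewrite -cardE card_tuple card_bool.
(* Balls are indexed by the rank of their word in the enumeration [e]. *)
pose w j := nth [tuple of nseq n.+1 false] e j.
pose z j := real_complex R (code_point gamma n.+1 (nth false (w j)) 2^-1).
apply: (@le_trans _ _ (\esum_(j in `I_(2 ^ n.+1))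
    (dimh gamma (c * delta gamma n.+1))%:E)); last first.
  rewrite esum_fset//; last by move=> *; rewrite lee_fin dimh_ge0.
  rewrite -fsbig_ord sumEFin lee_fin sumr_const card_ord.
  rewrite -[c in leRHS]mulr1 -mulr_natl natrX.
  rewrite (le_trans (ler_wpM2l _ (dimh_scale _ hgamma _ _ c1 cg)))//.
  by rewrite mulrCA exprVn divff// expf_neq0// pnatr_eq0.
apply: ereal_inf_lbound; exists `I_(2 ^ n.+1), z, (fun=> c * delta gamma n.+1).
split=> //; first by move=> j _; rewrite cd andbT mulr_gt0//; lra.
move=> _ [x Kx <-]; have [v xv] := cantorK_near_code_point n.+1 x Kx.
exists (index v e); first by rewrite /= -se index_mem mem_enum.
rewrite /cball /z /= -rmorphB normc_def /= expr0n addr0 sqrtr_sqr ltcR.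
rewrite /w nth_index ?mem_enum// (le_lt_trans xv)//.
by rewrite -mulrA mulrC ltr_pM2r//; lra.
Qed.

End HausdorffBounds.

Theorem theorem2p1 (R : realType) (gamma : nat -> R)
    (hgamma : forall s : nat, (1 <= s)%N -> 0 < gamma s <= 32%:R^-1)
    (hsum : cvgn (fun n : nat => \sum_(1 <= s < n) gamma s)) :
  let M : R := 1 + expR (16%:R * limn (fun n : nat => \sum_(1 <= s < n) gamma s)) in
  ((8%:R^-1)%:E <= hausdorff_measure (dimh gamma) (embedC (cantorK gamma)))%E /\
  (hausdorff_measure (dimh gamma) (embedC (cantorK gamma)) <= (M / 2%:R)%:E)%E.
Proof.
move=> M.
have cvgH := @hausdorff_content_cvg R (dimh gamma) (embedC (cantorK gamma)).
split.
  apply: lime_ge => //; near=> d.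
  apply: le_trans (hausdorff_content_ge _ hgamma d).
  by rewrite lee_fin lef_pV2 ?posrE// ler_nat.
set u := (fun n : nat => _) in hsum M *.
have uS n : u n.+2 = u n.+1 + gamma n.+1 by rewrite /u big_nat_recr.
have nd_u : nondecreasing_seq u.
  apply/nondecreasing_seqP => -[|n]; first by rewrite /u !big_geq.
  by rewrite uS lerDl; have /andP[/ltW] := hgamma n.+1 (ltn0Sn n).
have u_le n : u n <= limn u by exact: nondecreasing_cvgn_le.
have lim_gt0 : 0 < limn u.
  apply: lt_le_trans (u_le 2); rewrite uS /u big_geq// add0r.
  by have /andP[] := hgamma 1 isT.
have e1 : 1 < expR (16 * limn u) by rewrite expR_gt1 mulr_gt0.
have c1 : 1 < M / 2 by rewrite /M; lra.
(* The hypothesis [c * gamma_{n+1} <= 1] is met for large [n], as the terms of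
   a convergent series. *)
have gamma0 : (fun n => gamma n.+1) @ \oo --> (0 : R).
  rewrite -(subrr (limn u)).
  rewrite [X in X @ _](_ : _ = (fun n => u n.+2 - u n.+1)); last first.
    by apply/funext => n; rewrite uS addrC addKr.
  have us : u n.+1 @[n --> \oo] --> limn u by rewrite cvg_shiftS.
  by apply: cvgB => //; rewrite (cvg_shiftS (fun n => u n.+1)).
apply: lime_le => //; near=> d.
have d0 : 0 < d by near: d; exact: nbhs_right_gt.
have dc0 : 0 < d / (M / 2) by rewrite divr_gt0//; lra.
have c0 : 0 < (M / 2)^-1 by rewrite invr_gt0; lra.
near \oo => n.
apply: (hausdorff_content_le _ hgamma n) => //.
- rewrite -ler_pdivlMl ?mulr1; last lra.
  by apply: ltW; near: n; exact: (cvgr_lt _ gamma0).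
- rewrite -ler_pdivlMl; last lra.
  rewrite mulrC ltW// (lt_trans (delta_decr hgamma n))//.
  by near: n; exact: near_delta_lt.
- rewrite mulrCA divff ?mulr1 ?pnatr_eq0// /M.
  by rewrite -[ltLHS]add0r ltr_leD// ler_expR ler_pM2l// u_le.
Unshelve. all: by end_near. Qed.
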